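(* There exists an infinite number of maximal circle packings with the Apollonian property. That is, there are infinitely many packings $\mathcal P\subset\mathbb R^{1,3}$, pairwise inequivalent (see context), each of which is maximal and has the Apollonian property.
   Context: $\mathbb R^{1,3}$ is the space of real $4$-tuples with a fixed symmetric bilinear form $\mathbf u\cdot\mathbf v=\mathbf u^TJ\mathbf v$, where $J$ is a symmetric matrix of signature $(1,3)$ (one positive and three negative eigenvalues). One sheet $\mathcal H$ of the hyperboloid $\mathbf x\cdot\mathbf x=1$ is a model of $\mathbb H^3$; a vector $\mathbf n$ with $\mathbf n\cdot\mathbf n<0$ represents the oriented plane $\{\mathbf x\in\mathcal H:\mathbf n\cdot\mathbf x=0\}$, hence an oriented circle (or line) on the boundary of $\mathcal H$. A set $\mathcal P\subset\mathbb R^{1,3}$ is a (circle) packing if there is a $k>0$ such that $\mathbf n\cdot\mathbf n=-k$ for all $\mathbf n\in\mathcal P$ and $\mathbf n\cdot\mathbf n'\ge k$ for all distinct $\mathbf n,\mathbf n'\in\mathcal P$ (trivial packings of the form $\{\mathbf n,-\mathbf n\}$ are ignored). Elements of $\mathcal P$ are called its circles; two distinct circles $\mathbf n,\mathbf n'\in\mathcal P$ are tangent exactly when $\mathbf n\cdot\mathbf n'=k$. A packing $\mathcal P$ is maximal if no vector can be added to $\mathcal P$ so that the result is still a packing. A packing has the Apollonian property if every circle in the packing is a member of a cluster of four mutually tangent circles, i.e. for every $\mathbf n\in\mathcal P$ there are $\mathbf n_1,\mathbf n_2,\mathbf n_3\in\mathcal P$ such that $\mathbf n,\mathbf n_1,\mathbf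 n_2,\mathbf n_3$ are four distinct circles, any two of which are tangent. Convention: circle packings that are equivalent under inversion (Möbius transformations and inversions of the boundary) are regarded as different perspectives of the same packing. In terms of vectors, two packings $\mathcal P,\mathcal P'$ are equivalent if $\mathcal P'=c\,T(\mathcal P)$ for some $c>0$ and some linear map $T$ of $\mathbb R^{1,3}$ preserving the bilinear form and mapping $\mathcal H$ to itself. *)

(* Defs.v *)
From HB Require Import structures.
From mathcomp Require Import all_boot all_order all_algebra.
From mathcomp Require Import all_classical all_reals all_analysis.
Set Implicit Arguments.
Unset Strict Implicit.
Unset Printing Implicit Defensive.
Import Order.TTheory GRing.Theory Num.Theory.
Import numFieldNormedType.Exports.

Local Open Scope classical_set_scope.
Local Open Scope ring_scope.

Section Packings.
Context {R : realType}.
Implicit Types (J : 'M[R]_4) (H P Q : set 'cV[R]_4) (u v n x : 'cV[R]_4).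
Implicit Types (k : R).

(* Eigenvalues are counted with multiplicity, as roots of the characteristic
   polynomial. *)
Definition signature13 J : Prop :=
  J^T = J /\
  exists a b1 b2 b3 : R,
    [/\ 0 < a, b1 < 0, b2 < 0, b3 < 0 &
        char_poly J = ('X - a%:P) * ('X - b1%:P) * ('X - b2%:P) * ('X - b3%:P)].

Definition dot J u v : R := (u^T *m J *m v) 0 0.

Definition hyperboloid J : set 'cV[R]_4 := [set x | dot J x x = 1].

Definition is_sheet J H : Prop :=
  exists2 x, hyperboloid J x & H = connected_component (hyperboloid J) x.

Definition packing_with J k P : Prop :=
  [/\ 0 < k,
      forall n, P n -> dot J n n = - k &
      forall n n', P n -> P n' -> n <> n' -> k <= dot J n n'].

Definition trivial_packing P : Prop := exists n, P = [set n; - n].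

Definition is_packing J P : Prop :=
  (exists k, packing_with J k P) /\ ~ trivial_packing P.

Definition maximal_packing J P : Prop :=
  is_packing J P /\ forall v, ~ P v -> ~ is_packing J (v |` P).

Definition tangent J k n n' : Prop := n <> n' /\ dot J n n' = k.

(* The constant k is determined by P as soon as P is nonempty. *)
Definition apollonian J P : Prop :=
  exists2 k, packing_with J k P &
    forall n, P n -> exists n1 n2 n3,
      [/\ [/\ P n1, P n2 & P n3],
          [/\ tangent J k n n1, tangent J k n n2 & tangent J k n n3] &
          [/\ tangent J k n1 n2, tangent J k n1 n3 & tangent J k n2 n3]].

Definition equivalent_packings J H P Q : Prop :=
  exists (c : R) (T : {linear 'cV[R]_4 -> 'cV[R]_4}),
    [/\ 0 < c,
        forall u v, dot J (T u) (T v) = dot J u v,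
        T @` H = H &
        Q = [set c *: T n | n in P]].

End Packings.

(* Main.v *)
Require Import Defs.
From HB Require Import structures.
From mathcomp Require Import all_boot all_order all_algebra.
From mathcomp Require Import all_classical all_reals all_analysis.
From mathcomp Require Import ring lra.
Set Implicit Arguments.
Unset Strict Implicit.
Unset Printing Implicit Defensive.
Import Order.TTheory GRing.Theory Num.Theory.
Import numFieldNormedType.Exports.
Local Open Scope classical_set_scope.
Local Open Scope ring_scope.

(** The proof does not describe the packings explicitly: it produces them with
    Zorn's lemma and tells them apart by a cardinality argument.

    In coordinates where the form is (a b' + b a') / 2 - x x' - y y'
    ([light_cone_coordinates]), a vector v with v.v = -1 is an oriented circle of
    the plane, with bend b, centre (x / b, y / b) and co-bend a; its disc is the
    set of points z with v.p(z) < 0, where p(z) is the null vector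
    [null_point z]. Let the cone be the set of future-pointing causal vectors. It
    is closed under addition, and any two of its members have a nonnegative
    product. For vectors of norm -1, the sum n + n' lies in the cone exactly when
    the discs of n and n' have disjoint interiors, and w - v lies in the cone
    exactly when the disc of w lies in the disc of v. So if w is inside v and v is
    disjoint from n, then w is disjoint from n simply because
    n + w = (n + v) + (w - v).

    Existence. Among the Apollonian packings of disjoint discs that contain a
    given one, Zorn's lemma gives a P that cannot be enlarged within this class.
    Such a P is a maximal packing ([inextensible_maximal]): if a vector v could be
    added to P, then v would be disjoint from all discs of P; but any disc contains
    four mutually tangent smaller discs ([quad_inside]), and adding these four to P
    gives a larger Apollonian packing.

    Inequivalence. The set of products n.n' of a packing normalized by n.n = -1 is
    invariant under equivalence ([dot_values_equivalent]) and countable, since the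
    discs are disjoint and each contains a rational point
    ([cone_packing_countable]). Seeding the construction with two copies of a
    tangent quadruple at distance t gives a packing P(t) in which the product
    2 t^2 - 1 occurs. If only finitely many sets of products arose, their union
    would be countable and yet contain 2 t^2 - 1 for all t >= 3. One packing for
    each of the infinitely many sets of products is therefore an infinite family
    of pairwise inequivalent packings. *)

(** * Orthogonal diagonalization of symmetric matrices *)

Lemma row_normE (R : comNzRingType) n (u : 'rV[R]_n) :
  (u *m u^T) 0 0 = \sum_k u 0 k ^+ 2.
Proof. by rewrite mxE; apply: eq_bigr => k _; rewrite mxE. Qed.

Lemma row_norm_ge0 (R : realDomainType) n (u : 'rV[R]_n) : 0 <= (u *m u^T) 0 0.
Proof. by rewrite row_normE sumr_ge0 // => k _; exact: sqr_ge0. Qed.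

Lemma row_norm_eq0 (R : realDomainType) n (u : 'rV[R]_n) :
  (u *m u^T) 0 0 = 0 -> u = 0.
Proof.
move/eqP; rewrite row_normE psumr_eq0 => [/allP u0|k _]; last exact: sqr_ge0.
apply/rowP => j; have := u0 j; rewrite mem_index_enum sqrf_eq0 mxE.
by move=> /(_ isT)/eqP.
Qed.

(** The matrix is the Householder reflection that exchanges v and the first basis
    vector. *)
Lemma unit_row_orthogonal_completion (R : rcfType) n (v : 'rV[R]_(1 + n)) :
  v *m v^T = 1%:M ->
  exists2 Q : 'M[R]_(1 + n), Q *m Q^T = 1%:M & row 0 Q = v.
Proof.
move=> vv; pose e : 'rV[R]_(1 + n) := delta_mx 0 0.
have ee : e *m e^T = 1%:M.
  by rewrite trmx_delta mul_delta_mx; apply/matrixP => i j; rewrite !mxE !ord1.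
have [->|wN0] := eqVneq v e.
  by exists 1%:M; rewrite ?trmx1 ?mul1mx // rowE mulmx1.
(* The reflection is in the hyperplane orthogonal to w, with w.w = 2 c. *)
pose w : 'rV[R]_(1 + n) := v - e; pose c : R := 1 - (v *m e^T) 0 0.
have ve : v *m e^T = (1 - c)%:M by rewrite [LHS]mx11_scalar /c subKr.
have ev : e *m v^T = (1 - c)%:M by rewrite -[LHS]trmxK trmx_mul trmxK ve tr_scalar_mx.
have ww : w *m w^T = (c *+ 2)%:M.
  rewrite /w linearB /= mulmxBl !mulmxBr vv ve ev ee -!raddfB /=; congr _%:M; ring.
have cN0 : c != 0.
  apply: contra_neq wN0 => c0; apply/eqP; rewrite -subr_eq0 -/w; apply/eqP.
  by apply: row_norm_eq0; rewrite ww c0 mul0rn mxE mul0rn.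
have ew : e *m w^T = (- c)%:M.
  by rewrite /w linearB /= mulmxBr ev ee -raddfB /=; congr _%:M; ring.
have wve : w + e = v by rewrite subrK.
move: w c ww cN0 ew wve {ev ve wN0} => w c ww cN0 ew wve.
pose W := w^T *m w; pose Q := 1%:M - c^-1 *: W.
have QT : Q^T = Q by rewrite /Q linearB /= trmx1 linearZ /= trmx_mul trmxK.
have WW : W *m W = (c *+ 2) *: W.
  by rewrite /W mulmxA -(mulmxA w^T w w^T) ww mul_mx_scalar -scalemxAl.
exists Q.
  rewrite QT mulmxBl mul1mx mulmxBr mulmx1 -scalemxAl -scalemxAr scalerA WW scalerA.
  have -> : c^-1 * c^-1 * (c *+ 2) = c^-1 + c^-1 by field.
  by rewrite scalerDl opprB addrK subrK.
rewrite rowE -/e /Q mulmxBr mulmx1 -scalemxAr mulmxA ew mul_scalar_mx scalerA.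
by rewrite mulrN mulVf // scaleN1r opprK addrC.
Qed.

(** Deflation: conjugating by an orthogonal matrix whose first row is a unit
    eigenvector for the first root splits off a 1 x 1 block, and by symmetry leaves a
    symmetric block whose characteristic polynomial has the remaining roots. The
    diagonal comes in the order of the given list of roots, so that the position
    of the positive eigenvalue is known afterwards. *)
Lemma symmetric_split_diagonalization (R : rcfType) n (A : 'M[R]_n) (s : seq R) :
  A^T = A -> char_poly A = \prod_(x <- s) ('X - x%:P) ->
  exists2 Q : 'M[R]_n, Q *m Q^T = 1%:M &
    Q *m A *m Q^T = diag_mx (\row_i s`_i).
Proof.
elim: n A s => [|n IHn] A s symA chA.
  by exists 1%:M; apply/matrixP => -[].
have := size_char_poly A; rewrite chA size_prod_XsubC => -[].
case: s chA => [//|x s] chA _.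
have /eigenvalueP[u uA uN0] : eigenvalue A x.
  by rewrite eigenvalue_root_char chA root_prod_XsubC mem_head.
pose N := (u *m u^T) 0 0.
have N_gt0 : 0 < N.
  rewrite lt_def row_norm_ge0 andbT; exact: contra_neq (@row_norm_eq0 _ _ _) uN0.
pose v := (Num.sqrt N)^-1 *: u.
have vv : v *m v^T = 1%:M.
  rewrite /v linearZ /= -scalemxAl -scalemxAr scalerA [u *m _]mx11_scalar -/N.
  rewrite scale_scalar_mx -invfM -expr2 sqr_sqrtr ?mulVf ?lt0r_neq0 //; exact: ltW.
have vA : v *m A = x *: v by rewrite -scalemxAl uA !scalerA mulrC.
have [Q QQ Q0] := @unit_row_orthogonal_completion R n v vv.
pose B : 'M[R]_(1 + n) := Q *m A *m Q^T.
have symB : B^T = B by rewrite /B !trmx_mul trmxK symA mulmxA.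
have B0 : row 0 B = (x *: delta_mx 0 0).
  rewrite /B !row_mul Q0 vA -scalemxAl -[v *m _]mulmx1 -{1}Q0 rowE.
  by rewrite -!mulmxA (mulmxA Q) QQ mul1mx mulmx1.
have Bur : ursubmx B = 0.
  apply/matrixP => i j; rewrite !mxE ord1; move/rowP/(_ (rshift 1 j)): B0.
  by rewrite !mxE lshift0 mulr0.
have Bdl : dlsubmx B = 0 by rewrite -[dlsubmx B]trmxK trmx_dlsub symB Bur trmx0.
have Bul : ulsubmx B = x%:M.
  apply/matrixP => i j; rewrite !mxE !ord1; move/rowP/(_ 0): B0.
  by rewrite !mxE lshift0 !mulr1.
have BE : B = block_mx x%:M 0 0 (drsubmx B) by rewrite -{1}(submxK B) Bul Bur Bdl.
have chB : char_poly B = char_poly A.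
  have PQQ : map_mx polyC Q *m map_mx polyC Q^T = 1%:M by rewrite -map_mxM QQ map_mx1.
  rewrite /char_poly.
  have -> : char_poly_mx B = map_mx polyC Q *m char_poly_mx A *m map_mx polyC Q^T.
    rewrite /char_poly_mx mulmxBr mulmxBl -!map_mxM; congr (_ - _).
    by rewrite scalar_mxC -mulmxA PQQ mulmx1.
  by rewrite !det_mulmx mulrC mulrA -det_mulmx (mulmx1C PQQ) det1 mul1r.
have symd : (drsubmx B)^T = drsubmx B by rewrite trmx_drsub symB.
move: (drsubmx B) BE symd => D BE symD.
have chD : char_poly D = \prod_(y <- s) ('X - y%:P).
  move: chB; rewrite chA BE /char_poly char_block_diag_mx det_lblock -/(char_poly _).
  rewrite big_cons det_mx11 !mxE eqxx !mulr1n.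
  by move/(mulfI (negbT (polyXsubC_eq0 x))).
have [P PP PB] := IHn _ _ symD chD.
pose P1 : 'M[R]_(1 + n) := block_mx 1%:M 0 0 P.
have P1T : P1^T = block_mx 1%:M 0 0 P^T by rewrite tr_block_mx !trmx0 trmx1.
have PP1 : P1 *m P1^T = 1%:M.
  rewrite P1T mulmx_block !mulmx0 !mul0mx !addr0 !add0r mulmx1 PP.
  by rewrite -scalar_mx_block.
have PBP : P1 *m B *m P1^T = block_mx x%:M 0 0 (diag_mx (\row_i s`_i)).
  rewrite P1T BE !mulmx_block !mulmx0 !mul0mx !addr0 !add0r mulmx1 mul1mx.
  by rewrite PB !mul0mx.
exists (P1 *m Q).
  by rewrite trmx_mul mulmxA -(mulmxA P1) QQ mulmx1 PP1.
have -> : P1 *m Q *m A *m (P1 *m Q)^T = P1 *m B *m P1^T.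
  by rewrite trmx_mul /B !mulmxA.
rewrite PBP; apply/matrixP => i j.
case: (@split_ordP 1 n i) => k ->; case: (@split_ordP 1 n j) => l ->.
- by rewrite (@block_mxEul _ 1 n 1 n) !mxE !ord1.
- by rewrite (@block_mxEur _ 1 n 1 n) !mxE ord1 -val_eqE.
- by rewrite (@block_mxEdl _ 1 n 1 n) !mxE ord1 -val_eqE.
- by rewrite (@block_mxEdr _ 1 n 1 n) !mxE -!val_eqE.
Qed.

(** * Light-cone coordinates *)

Definition row_form (R : realType) n (r : 'rV[R]_n) (u : 'cV[R]_n) : R :=
  (r *m u) 0 0.

Fact row_form_is_nmod_morphism (R : realType) n (r : 'rV[R]_n) :
  nmod_morphism (row_form r).
Proof.
by split=> [|u v]; rewrite /row_form ?mulmx0 ?mulmxDr mxE.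
Qed.

HB.instance Definition _ (R : realType) n (r : 'rV[R]_n) :=
  GRing.isNmodMorphism.Build _ _ (row_form r) (row_form_is_nmod_morphism r).

Lemma sum_ord4 (V : nmodType) (F : 'I_4 -> V) :
  \sum_i F i = F 0 + F 1 + F 2%:R + F 3%:R.
Proof.
rewrite !big_ord_recl big_ord0 addr0 !addrA.
by congr (_ + F _ + F _ + F _); apply: val_inj.
Qed.

(** Scaling orthonormal eigenvectors by the square roots of the absolute values
    of the eigenvalues gives coordinates X0, X1, X2, X3 in which the form is
    X0^2 - X1^2 - X2^2 - X3^2; then a = X0 + X3 and b = X0 - X3. *)
Lemma light_cone_coordinates (R : realType) (J : 'M[R]_4) : signature13 J ->
  exists (a b x y : {additive 'cV[R]_4 -> R}) (mk : R -> R -> R -> R -> 'cV[R]_4),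
    (forall u v, dot J u v = (a u * b v + b u * a v) / 2 - x u * x v - y u * y v)
    /\ (forall p q r s, [/\ a (mk p q r s) = p, b (mk p q r s) = q,
                         x (mk p q r s) = r & y (mk p q r s) = s]).
Proof.
move=> [symJ [d0 [d1 [d2 [d3 [d0_gt0 d1_lt0 d2_lt0 d3_lt0 chJ]]]]]].
have [|Q QQ QJ] := @symmetric_split_diagonalization R 4 J [:: d0; d1; d2; d3] symJ.
  by rewrite chJ !big_cons big_nil mulr1 !mulrA.
have QQ' := mulmx1C QQ.
pose t i : 'cV_4 -> R := row_form (row i Q).
have dotE u v : dot J u v = d0 * (t 0 u * t 0 v) + d1 * (t 1 u * t 1 v)
    + d2 * (t 2%:R u * t 2%:R v) + d3 * (t 3%:R u * t 3%:R v).
  have tE i w : t i w = (Q *m w) i 0 by rewrite /t /row_form -row_mul mxE.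
  have -> : J = Q^T *m diag_mx (\row_i [:: d0; d1; d2; d3]`_i) *m Q.
    by rewrite -QJ !mulmxA QQ' mul1mx -mulmxA QQ' mulmx1.
  rewrite /dot !mulmxA -trmx_mul -!mulmxA mul_diag_mx mxE sum_ord4.
  rewrite !tE; move: (Q *m u) (Q *m v) => U V; rewrite !mxE /=; ring.
pose s i := Num.sqrt (- nth 0 [:: d0; d1; d2; d3] i).
have s_sqr i : nth 0 [:: d0; d1; d2; d3] i < 0 -> s i ^+ 2 = - nth 0 [:: d0; d1; d2; d3] i.
  by move=> d_lt0; rewrite sqr_sqrtr // oppr_ge0 ltW.
have s_neq0 i : nth 0 [:: d0; d1; d2; d3] i < 0 -> s i != 0.
  by move=> d_lt0; rewrite lt0r_neq0 // sqrtr_gt0 oppr_gt0.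
have := s_sqr 1%N d1_lt0; have := s_sqr 2%N d2_lt0; have := s_sqr 3%N d3_lt0.
have := s_neq0 1%N d1_lt0; have := s_neq0 2%N d2_lt0; have := s_neq0 3%N d3_lt0.
move: (s 1%N) (s 2%N) (s 3%N) => s1 s2 s3 /= s3N0 s2N0 s1N0 s3E s2E s1E.
have s0E : Num.sqrt d0 ^+ 2 = d0 by rewrite sqr_sqrtr // ltW.
have s0N0 : Num.sqrt d0 != 0 by rewrite lt0r_neq0 // sqrtr_gt0.
move: (Num.sqrt d0) s0E s0N0 => s0 s0E s0N0.
exists (row_form (s0 *: row 0 Q + s3 *: row 3%:R Q)).
exists (row_form (s0 *: row 0 Q - s3 *: row 3%:R Q)).
exists (row_form (s1 *: row 1 Q)), (row_form (s2 *: row 2%:R Q)).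
pose z p q r w := [:: (p + q) / (2 * s0); r / s1; w / s2; (p - q) / (2 * s3)].
exists (fun p q r w => Q^T *m \col_i (z p q r w)`_i).
have formD r r' u : row_form (r + r') u = row_form r u + row_form r' u.
  by rewrite /row_form mulmxDl mxE.
have formN r u : row_form (- r) u = - row_form r u.
  by rewrite /row_form mulNmx mxE.
have formZ c r u : row_form (c *: r) u = c * row_form r u.
  by rewrite /row_form -scalemxAl mxE.
split=> [u v|p q r w] /=.
  rewrite dotE -s0E -[d1]opprK -s1E -[d2]opprK -s2E -[d3]opprK -s3E.
  by rewrite !formD !formN !formZ -!/(t _ _); field.
have tz i : t i (Q^T *m \col_i (z p q r w)`_i) = (z p q r w)`_i.
  by rewrite /t /row_form mulmxA -row_mul QQ row1 -rowE !mxE.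
rewrite !formD !formN !formZ -!/(t _ _) !tz /=.
by split; field; rewrite ?s0N0 ?s1N0 ?s2N0 ?s3N0.
Qed.

(** * Rational points in a disc *)

Lemma rat_mul_gt (R : realType) (A X : R) : X != 0 ->
  exists q : rat, A < X * ratr q.
Proof.
move=> /lt_total/orP[X0|X0].
  have [q] := @rat_in_itvoo R (A / X - 1) (A / X) ltac:(lra).
  by rewrite in_itv /= => /andP[_ qA]; exists q; rewrite mulrC -ltr_ndivlMr.
have [q] := @rat_in_itvoo R (A / X) (A / X + 1) ltac:(lra).
by rewrite in_itv /= => /andP[qA _]; exists q; rewrite mulrC -ltr_pdivrMr.
Qed.

(** For B > 0 the solutions form a disc of centre (X / B, Y / B), for B < 0 the
    complement of a disc, and for B = 0 a half-plane, all of them open; the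
    hypothesis says that the radius is positive, resp. that the boundary line is
    not degenerate. *)
Lemma rat_solution_of_quadratic (R : realType) (A B X Y : R) :
  A * B < X ^+ 2 + Y ^+ 2 -> exists q : rat * rat,
  A + B * (ratr q.1 ^+ 2 + ratr q.2 ^+ 2) - 2 * X * ratr q.1 - 2 * Y * ratr q.2 < 0.
Proof.
move=> h; have [B0|B0] := ltP 0 B.
  pose e := Num.sqrt ((X ^+ 2 + Y ^+ 2 - A * B) / (2 * B ^+ 2)).
  have e2 : 2 * (B ^+ 2 * e ^+ 2) = X ^+ 2 + Y ^+ 2 - A * B.
    rewrite sqr_sqrtr; first by field; rewrite lt0r_neq0.
    by apply: divr_ge0; [lra | rewrite mulr_ge0 ?sqr_ge0].
  have e0 : 0 < e by rewrite sqrtr_gt0; apply: divr_gt0; [lra | rewrite mulr_gt0 ?exprn_gt0].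
  have close c : exists q : rat, (B * (ratr q - c / B)) ^+ 2 < B ^+ 2 * e ^+ 2.
    have [q] := @rat_in_itvoo R (c / B - e) (c / B + e) ltac:(lra).
    rewrite in_itv /= => /andP[q1 q2]; exists q.
    rewrite exprMn ltr_pM2l ?exprn_gt0 // -[ltRHS]ger0_norm ?sqr_ge0 // normrX.
    rewrite (ger0_norm (ltW e0)).
    rewrite -real_normK ?num_real // ltr_pXn2r ?nnegrE ?(ltW e0) //.
    by rewrite ltr_norml; lra.
  have [q1 h1] := close X; have [q2 h2] := close Y; exists (q1, q2) => /=.
  rewrite -(pmulr_rlt0 _ B0).
  have E c q : (B * (q - c / B)) ^+ 2 = (B * q - c) ^+ 2 by field; rewrite lt0r_neq0.
  by move: h1 h2; rewrite !E; lra.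
have two_neq0 : 2%:R != 0 :> R by rewrite pnatr_eq0.
have [X0|X0] := eqVneq X 0; last first.
  have [q hq] := rat_mul_gt A (mulf_neq0 two_neq0 X0).
  exists (q, 0) => /=; rewrite raddf0.
  by have : 0 <= ratr q ^+ 2 :> R := sqr_ge0 _; nra.
have [Y0|Y0] := eqVneq Y 0; last first.
  have [q hq] := rat_mul_gt A (mulf_neq0 two_neq0 Y0).
  exists (0, q) => /=; rewrite raddf0.
  by have : 0 <= ratr q ^+ 2 :> R := sqr_ge0 _; nra.
move: h; rewrite X0 Y0 expr0n /= addr0 => AB.
have {B0} B0 : B < 0.
  by rewrite lt_neqAle B0 andbT; apply: contraTneq AB => ->; rewrite mulr0 ltxx.
have [q hq] : exists q : rat, A - B < - B * ratr q.
  by apply: rat_mul_gt; rewrite oppr_eq0 lt_eqF.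
exists (q, 0) => /=; rewrite raddf0.
have : 0 < - B * (1 - ratr q + ratr q ^+ 2).
  by apply: mulr_gt0; [lra | have := sqr_ge0 (ratr q - 1 / 2 : R); lra].
by lra.
Qed.

(** * The causal cone *)

Section LightCone.
Context {R : realType} (J : 'M[R]_4) (a b x y : {additive 'cV[R]_4 -> R})
  (mk : R -> R -> R -> R -> 'cV[R]_4).
Context
  (dotE : forall u v,
    dot J u v = (a u * b v + b u * a v) / 2 - x u * x v - y u * y v)
  (mkE : forall p q r s, [/\ a (mk p q r s) = p, b (mk p q r s) = q,
                             x (mk p q r s) = r & y (mk p q r s) = s]).
Implicit Types (u v w n : 'cV[R]_4) (P Q : set 'cV[R]_4).

Let amk p q r s : a (mk p q r s) = p. Proof. by case: (mkE p q r s). Qed.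
Let bmk p q r s : b (mk p q r s) = q. Proof. by case: (mkE p q r s). Qed.
Let xmk p q r s : x (mk p q r s) = r. Proof. by case: (mkE p q r s). Qed.
Let ymk p q r s : y (mk p q r s) = s. Proof. by case: (mkE p q r s). Qed.
Let mkEs := (amk, bmk, xmk, ymk).

Lemma dotC u v : dot J u v = dot J v u.
Proof. by rewrite !dotE; ring. Qed.

Lemma dotDl u v w : dot J (u + v) w = dot J u w + dot J v w.
Proof. by rewrite !dotE !raddfD /=; ring. Qed.

Lemma dotNl u v : dot J (- u) v = - dot J u v.
Proof. by rewrite !dotE !raddfN /=; ring. Qed.

Lemma dotDr u v w : dot J w (u + v) = dot J w u + dot J w v.
Proof. by rewrite dotC dotDl !(dotC _ w). Qed.

Lemma dotNr u v : dot J u (- v) = - dot J u v.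
Proof. by rewrite dotC dotNl dotC. Qed.

Definition causal u : Prop := [/\ 0 <= a u, 0 <= b u & 0 <= dot J u u].

(** The reversed Cauchy-Schwarz inequality: after the ordinary one for (x, y), it
    reduces to the inequality of arithmetic and geometric means for a b' and
    b a'. *)
Lemma causal_dot_ge0 u v : causal u -> causal v -> 0 <= dot J u v.
Proof.
move=> [au bu uu] [av bv vv]; move: uu vv; rewrite !dotE.
move: (a u) (b u) (x u) (y u) (a v) (b v) (x v) (y v) au bu av bv.
move=> A B X Y A' B' X' Y' A0 B0 A0' B0' uu vv.
have {}uu : X ^+ 2 + Y ^+ 2 <= A * B by lra.
have {}vv : X' ^+ 2 + Y' ^+ 2 <= A' * B' by lra.
suff : 2 * (X * X' + Y * Y') <= A * B' + B * A' by lra.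
have p0 : 0 <= A * B' + B * A' by rewrite addr_ge0 ?mulr_ge0.
apply: le_trans (ler_norm _) _; rewrite -(ler_pXn2r (n := 2)) ?nnegrE //.
rewrite -normrX ger0_norm ?sqr_ge0 //.
have h : (X ^+ 2 + Y ^+ 2) * (X' ^+ 2 + Y' ^+ 2) <= (A * B) * (A' * B').
  by apply: ler_pM => //; rewrite addr_ge0 ?sqr_ge0.
have := sqr_ge0 (A * B' - B * A'); have := sqr_ge0 (X * Y' - X' * Y).
by nra.
Qed.

Lemma causalD u v : causal u -> causal v -> causal (u + v).
Proof.
move=> cu cv; have uv := causal_dot_ge0 cu cv.
case: cu cv => au bu uu [av bv vv]; split; rewrite ?raddfD ?addr_ge0 //.
by rewrite dotDl !dotDr (dotC v u); lra.
Qed.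

Lemma causal_or_opp u : 0 <= dot J u u -> causal u \/ causal (- u).
Proof.
move=> uu; have := uu; rewrite dotE => h.
rewrite /causal dotNl dotNr opprK !raddfN /= !oppr_ge0.
have hx := sqr_ge0 (x u); have hy := sqr_ge0 (y u).
have ab : 0 <= a u * b u by nra.
have [a0|a0] := ltP 0 (a u); first by left; split=> //; nra.
have [b0|b0] := ltP 0 (b u); first by left; split=> //; nra.
by right; split.
Qed.

Lemma causal_of_pos u : 0 < b u -> 0 <= dot J u u -> causal u.
Proof.
move=> b0 /causal_or_opp[//|[_]].
by rewrite raddfN oppr_ge0 => /(lt_le_trans b0); rewrite ltxx.
Qed.

Lemma spacelike_double u : dot J u u < 0 -> ~ causal (u + u).
Proof. by move=> uu [_ _]; rewrite dotDl !dotDr; lra. Qed.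

(** * Discs of the plane *)

(** The circle of centre (z1, z2) and radius r, with bend 1 / r. *)
Definition disc (z1 z2 r : R) : 'cV[R]_4 :=
  mk ((z1 ^+ 2 + z2 ^+ 2 - r ^+ 2) / r) r^-1 (z1 / r) (z2 / r).

(** The point (z1, z2) of the plane, as a generator of the cone. *)
Definition null_point (z1 z2 : R) : 'cV[R]_4 := mk (z1 ^+ 2 + z2 ^+ 2) 1 z1 z2.

Lemma dot_point v z1 z2 : dot J v (null_point z1 z2) =
  (a v + b v * (z1 ^+ 2 + z2 ^+ 2)) / 2 - x v * z1 - y v * z2.
Proof.
by rewrite dotE !mkEs; ring.
Qed.

Lemma causal_point z1 z2 : causal (null_point z1 z2).
Proof.
by apply: causal_of_pos; rewrite ?dot_point !mkEs //; lra.
Qed.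

Lemma dot_disc v z1 z2 r : r != 0 -> dot J v (disc z1 z2 r) =
  (a v + b v * (z1 ^+ 2 + z2 ^+ 2 - r ^+ 2) - 2 * (x v * z1) - 2 * (y v * z2))
  / (2 * r).
Proof.
by move=> r0; rewrite dotE !mkEs; field.
Qed.

Lemma dot_discs z1 z2 r z1' z2' r' : r != 0 -> r' != 0 ->
  dot J (disc z1 z2 r) (disc z1' z2' r') =
  ((z1 - z1') ^+ 2 + (z2 - z2') ^+ 2 - r ^+ 2 - r' ^+ 2) / (2 * r * r').
Proof.
move=> r0 r0'; rewrite dot_disc // !mkEs.
by field; rewrite r0 r0'.
Qed.

Lemma dot_disc_self z1 z2 r : r != 0 -> dot J (disc z1 z2 r) (disc z1 z2 r) = -1.
Proof. by move=> r0; rewrite dot_discs //; field. Qed.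

Lemma b_disc z1 z2 r : b (disc z1 z2 r) = r^-1.
Proof. exact: bmk. Qed.

(** The hypothesis says that the product of the two discs is at least 1; as both
    bends are positive, the sum of the vectors points to the future. *)
Lemma disjoint_discs z1 z2 r z1' z2' r' : 0 < r -> 0 < r' ->
  (r + r') ^+ 2 <= (z1 - z1') ^+ 2 + (z2 - z2') ^+ 2 ->
  causal (disc z1 z2 r + disc z1' z2' r').
Proof.
move=> r0 r0' h; apply: causal_of_pos.
  by rewrite raddfD /= !b_disc addr_gt0 ?invr_gt0.
have rN := lt0r_neq0 r0; have rN' := lt0r_neq0 r0'.
rewrite dotDl !dotDr !dot_disc_self // (dotC (disc z1' _ _)) dot_discs //.
have : 1 <= ((z1 - z1') ^+ 2 + (z2 - z2') ^+ 2 - r ^+ 2 - r' ^+ 2) / (2 * r * r').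
  by rewrite ler_pdivlMr ?mulr_gt0 //; lra.
lra.
Qed.

Lemma rational_point_inside v : dot J v v < 0 ->
  exists q : rat * rat, dot J v (null_point (ratr q.1) (ratr q.2)) < 0.
Proof.
rewrite dotE => vv; pose A := a v; pose B := b v; pose X := x v; pose Y := y v.
have {vv} : A * B < X ^+ 2 + Y ^+ 2 by rewrite /A /B /X /Y; lra.
move=> /rat_solution_of_quadratic[q hq]; exists q.
by rewrite dot_point; move: hq; rewrite /A /B /X /Y; lra.
Qed.

(** * Four mutually tangent discs *)

(** A rational configuration: the discs of bends 2, 2, 3 in the unit circle, and
    the disc of bend 15 in the gap between them. *)
Definition quad_x (i : 'I_4) : R := nth 0 [:: 1 / 2; - (1 / 2); 0; 0] i.
Definition quad_y (i : 'I_4) : R := nth 0 [:: 0; 0; 2 / 3; 4 / 15] i.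
Definition quad_r (i : 'I_4) : R := nth 0 [:: 1 / 2; 1 / 2; 1 / 3; 1 / 15] i.

Lemma quad_tangent i j : i != j ->
  (quad_x i - quad_x j) ^+ 2 + (quad_y i - quad_y j) ^+ 2
  = (quad_r i + quad_r j) ^+ 2.
Proof.
rewrite /quad_x /quad_y /quad_r.
by case: i => [[|[|[|[|//]]]] ?]; case: j => [[|[|[|[|//]]]] ?] //= _; lra.
Qed.

Lemma quad_bounds i : [/\ `|quad_x i| <= 1, `|quad_y i| <= 1,
  0 < quad_r i & quad_r i <= 1 / 2].
Proof.
rewrite /quad_x /quad_y /quad_r.
by case: i => [[|[|[|[|//]]]] ?] /=; split; rewrite ?ler_norml; lra.
Qed.

Definition quad (z1 z2 s : R) (i : 'I_4) : 'cV[R]_4 :=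
  disc (z1 + s * quad_x i) (z2 + s * quad_y i) (s * quad_r i).

Lemma quad_r_gt0 s i : 0 < s -> 0 < s * quad_r i.
Proof. by move=> s0; rewrite mulr_gt0 //; case: (quad_bounds i). Qed.

Lemma dot_quad_self z1 z2 s i : 0 < s ->
  dot J (quad z1 z2 s i) (quad z1 z2 s i) = -1.
Proof. by move=> s0; rewrite dot_disc_self // lt0r_neq0 // quad_r_gt0. Qed.

Lemma quad_dist z1 z2 s i j : i != j ->
  (z1 + s * quad_x i - (z1 + s * quad_x j)) ^+ 2 +
  (z2 + s * quad_y i - (z2 + s * quad_y j)) ^+ 2
  = (s * quad_r i + s * quad_r j) ^+ 2.
Proof.
by move=> /quad_tangent h; rewrite -mulrDr exprMn -h; ring.
Qed.

Lemma dot_quad z1 z2 s i j : 0 < s -> i != j ->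
  dot J (quad z1 z2 s i) (quad z1 z2 s j) = 1.
Proof.
move=> s0 ij; have ri := quad_r_gt0 i s0; have rj := quad_r_gt0 j s0.
rewrite dot_discs ?lt0r_neq0 // quad_dist //.
move: (s * quad_r i) (s * quad_r j) ri rj => p q p0 q0.
by field; rewrite !lt0r_neq0.
Qed.

Lemma causal_quad z1 z2 s i j : 0 < s -> i != j ->
  causal (quad z1 z2 s i + quad z1 z2 s j).
Proof.
move=> s0 ij; apply: disjoint_discs; rewrite ?quad_r_gt0 //.
by rewrite quad_dist.
Qed.

(** Near a point z of the open disc of v, a small enough copy of the quadruple
    fits. In formulas, the product of v with a disc of radius s r centred at
    distance O(s) from z is (- g + O(s)) / (2 s r), where g > 0 measures how far
    inside z is, and this is at most -1 for small s. *)
Lemma quad_inside v : dot J v v = -1 ->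
  exists z1 z2 s, 0 < s /\ forall i, causal (quad z1 z2 s i - v).
Proof.
move=> vv; have [|[z1 z2] /=] := @rational_point_inside v; first by lra.
move: (ratr z1) (ratr z2) => {}z1 {}z2; rewrite dot_point => g_lt0.
pose g := 2 * (x v * z1) + 2 * (y v * z2) - a v - b v * (z1 ^+ 2 + z2 ^+ 2).
have g0 : 0 < g by rewrite /g; lra.
(* M bounds the terms of order s. *)
pose M := 2 * `|b v * z1 - x v| + 2 * `|b v * z2 - y v| + 2 * `|b v|.
have M0 : 0 <= M by rewrite /M; do 2?[apply: addr_ge0]; apply: mulr_ge0.
have d0 : 0 < g * (`|b v| + 1) + M + 1.
  by have : 0 <= `|b v| by []; have := mulr_gt0 g0 ltr01; nra.
(* This s is small enough for both requirements below: sb makes the bends of the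
   copy exceed that of v, and sM makes the products with v at most -1. *)
have [s s0 sE] : exists2 s, 0 < s & s * (g * (`|b v| + 1) + M + 1) = g.
  by exists (g / (g * (`|b v| + 1) + M + 1)); rewrite ?divr_gt0 ?divfK ?lt0r_neq0.
have sb : s * (`|b v| + 1) <= 1.
  rewrite -(ler_pM2l g0) mulr1 -[leRHS]sE.
  by rewrite mulrCA ler_pM2l // -addrA lerDl addr_ge0.
have sM : s * (M + 1) <= g.
  rewrite -[leRHS]sE ler_pM2l // -[leRHS]addrA lerDr; apply: mulr_ge0; first exact: ltW.
  by rewrite addr_ge0.
exists z1, z2, s; split=> // i; have [X1 Y1 r0 r1] := quad_bounds i.
have b_gt : b v < (s * quad_r i)^-1.
  rewrite -[ltRHS]mul1r ltr_pdivlMr ?mulr_gt0 //.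
  apply: le_lt_trans (_ : s * `|b v| * quad_r i < 1).
    by rewrite mulrCA mulrA ler_pM2r // ler_pM2l // ler_norm.
  have : 0 <= s * `|b v| by rewrite mulr_ge0 // ltW.
  by nra.
apply: causal_of_pos; first by rewrite raddfB /= b_disc subr_gt0.
rewrite dotDl !dotDr !dotNl !dotNr (dotC v) vv dot_quad_self // opprK.
suff : dot J v (quad z1 z2 s i) <= -1 by rewrite dotC; lra.
rewrite dot_disc ?lt0r_neq0 ?mulr_gt0 // ler_pdivrMr ?mulr_gt0 //.
have norm_mul_le (p q : R) : `|p| <= 1 -> p * q <= `|q|.
  by move=> p1; rewrite (le_trans (ler_norm _)) // normrM ler_piMl.
have s1 : s <= 1.
  by apply: le_trans sb; rewrite -[leLHS]mulr1 ler_pM2l // lerDr.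
have hX := norm_mul_le _ (b v * z1 - x v) X1.
have hY := norm_mul_le _ (b v * z2 - y v) Y1.
have X2 : quad_x i ^+ 2 <= 1 by rewrite -[leLHS]ger0_norm ?sqr_ge0 // normrX exprn_ile1.
have Y2 : quad_y i ^+ 2 <= 1 by rewrite -[leLHS]ger0_norm ?sqr_ge0 // normrX exprn_ile1.
have hb : b v * (s * ((quad_x i ^+ 2 + quad_y i ^+ 2 - quad_r i ^+ 2) / 2)) <= `|b v|.
  rewrite mulrC; apply: norm_mul_le; rewrite ler_norml.
  have := sqr_ge0 (quad_x i); have := sqr_ge0 (quad_y i).
  have : quad_r i ^+ 2 <= 1 by rewrite exprn_ile1 //; lra.
  have := sqr_ge0 (quad_r i).
  move: (quad_x i ^+ 2) (quad_y i ^+ 2) (quad_r i ^+ 2) X2 Y2.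
  move=> p q r p1 q1 r_ge0 r_le1 q_ge0 p_ge0.
  by apply/andP; split; nra.
have hr : s * (2 * quad_r i) <= s by rewrite -[leRHS]mulr1 ler_pM2l //; lra.
have : s * (2 * (quad_x i * (b v * z1 - x v)) + 2 * (quad_y i * (b v * z2 - y v))
   + 2 * (b v * (s * ((quad_x i ^+ 2 + quad_y i ^+ 2 - quad_r i ^+ 2) / 2)))) <= s * M.
  by rewrite ler_pM2l // /M; lra.
move: sM; rewrite /g; nra.
Qed.

(** * Apollonian packings of disjoint discs *)

(** Asking for n + n' in the cone is stronger than n.n' >= 1, which says only that
    n + n' or its opposite is in the cone: it fixes the side on which the discs
    are. *)
Definition cone_packing P : Prop :=
  (forall n, P n -> dot J n n = -1) /\
  (forall n n', P n -> P n' -> n <> n' -> causal (n + n')).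

(** Distinctness of the four circles is implied: a product equal to 1 excludes
    equal vectors when all have norm -1. *)
Definition clustered P : Prop := forall n, P n -> exists n1 n2 n3,
  [/\ [/\ P n1, P n2 & P n3],
      [/\ dot J n n1 = 1, dot J n n2 = 1 & dot J n n3 = 1] &
      [/\ dot J n1 n2 = 1, dot J n1 n3 = 1 & dot J n2 n3 = 1]].

Definition cone_apollonian P : Prop := cone_packing P /\ clustered P.

Lemma cone_packing_with P : cone_packing P -> packing_with J 1 P.
Proof.
move=> [Pn Pc]; split=> // n n' nP n'P nn'.
have [_ _] := Pc _ _ nP n'P nn'.
by rewrite dotDl !dotDr (dotC n' n) !Pn //; lra.
Qed.

Lemma apollonian_of_cone_apollonian P : cone_apollonian P -> apollonian J P.
Proof.
move=> [cP clP]; exists 1; first exact: cone_packing_with.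
have tangentP n n' : P n -> dot J n n' = 1 -> tangent J 1 n n'.
  move=> nP nn'; split=> // nE; move: nn'; rewrite -nE (proj1 cP) //; lra.
move=> n nP; have [n1 [n2 [n3 [[p1 p2 p3] [t1 t2 t3] [t12 t13 t23]]]]] := clP n nP.
by exists n1, n2, n3; split; [ | split; apply: tangentP | split; apply: tangentP].
Qed.

Lemma cone_apollonianU P Q : cone_apollonian P -> cone_apollonian Q ->
  (forall n n', P n -> Q n' -> n <> n' -> causal (n + n')) -> cone_apollonian (P `|` Q).
Proof.
move=> [[Pn Pc] Pcl] [[Qn Qc] Qcl] PQ; split; first split.
- by move=> n [/Pn|/Qn].
- move=> n n' [nP|nQ] [n'P|n'Q] nn'; [exact: Pc|exact: PQ| |exact: Qc].
  by rewrite addrC; apply: PQ => // /esym.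
- move=> n [/Pcl|/Qcl] [n1 [n2 [n3 [[p1 p2 p3] t u]]]];
    exists n1, n2, n3; split=> //; split; by [left|right].
Qed.

Lemma cone_apollonian_quad z1 z2 s : 0 < s -> cone_apollonian (range (quad z1 z2 s)).
Proof.
move=> s0; split; first split.
- by move=> _ [i _ <-]; exact: dot_quad_self.
- move=> _ _ [i _ <-] [j _ <-] ij; apply: causal_quad => //.
  by apply: contra_not_neq ij => ->.
- move=> _ [i _ <-]; exists (quad z1 z2 s (lift i 0)).
  exists (quad z1 z2 s (lift i 1)), (quad z1 z2 s (lift i 2%:R)).
  split; split; try (by eexists); apply: dot_quad => //;
    by rewrite ?neq_lift // (inj_eq (@lift_inj _ _)).
Qed.

(** Both requirements involve few circles at a time, and any two circles of the
    union lie in a single member of the chain. *)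
Lemma cone_apollonian_bigcup_chain S F : cone_apollonian S ->
  (forall X, F X -> cone_apollonian (S `|` X)) -> total_on F subset ->
  cone_apollonian (S `|` \bigcup_(X in F) X).
Proof.
move=> gS gF tF.
have cover2 n n' : (S `|` \bigcup_(X in F) X) n -> (S `|` \bigcup_(X in F) X) n' ->
    exists G, [/\ cone_apollonian G, G n, G n' & G `<=` S `|` \bigcup_(X in F) X].
  have sub X : F X -> S `|` X `<=` S `|` \bigcup_(X in F) X.
    by move=> FX m [|mX]; [left|right; exists X].
  move=> [nS|[X FX nX]] [n'S|[Y FY n'Y]].
  - by exists S; split=> // m; left.
  - by exists (S `|` Y); split; [exact: gF|left|right|exact: sub].
  - by exists (S `|` X); split; [exact: gF|right|left|exact: sub].
  - have [XY|YX] := tF X Y FX FY.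
    + by exists (S `|` Y); split; [exact: gF|right; apply: XY|right|exact: sub].
    + by exists (S `|` X); split; [exact: gF|right|right; apply: YX|exact: sub].
split; first split.
- by move=> n nP; have [G [[[Gn _] _] nG _ _]] := cover2 n n nP nP; exact: Gn.
- move=> n n' nP n'P; have [G [[[_ Gc] _] nG n'G _]] := cover2 n n' nP n'P.
  exact: Gc.
- move=> n nP; have [G [[_ Gcl] nG _ sG]] := cover2 n n nP nP.
  have [n1 [n2 [n3 [[p1 p2 p3] t u]]]] := Gcl n nG.
  by exists n1, n2, n3; split=> //; split; exact: sG.
Qed.

(** * Maximality *)

Lemma clustered_not_trivial P m : (forall n, P n -> dot J n n = -1) ->
  clustered P -> P m -> ~ trivial_packing P.
Proof.
move=> Pn Pcl mP [n PE].
have [m1 [m2 [m3 [[m1P m2P _] [mm1 mm2 _] [m12 _ _]]]]] := Pcl m mP.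
have nn : dot J n n = -1 by apply: Pn; rewrite PE; left.
have opposite p q : P p -> P q -> dot J p q = 1 ->
    (p = n /\ q = - n) \/ (p = - n /\ q = n).
  rewrite PE => -[->|->] [->|->]; rewrite ?dotNl ?dotNr ?opprK nn => pq;
    by [left|right|exfalso; clear PE; lra].
have not_both (p : 'cV[R]_4) : P p -> p = n -> p = - n -> False.
  by move=> pP pn pn'; have := Pn p pP; rewrite {2}pn' pn dotNr nn; clear PE; lra.
(* Among the three mutually tangent m, m1, m2, two lie on the same side. *)
have [[e e1]|[e e1]] := opposite _ _ mP m1P mm1;
have [[f f1]|[f f1]] := opposite _ _ mP m2P mm2;
have [[g g1]|[g g1]] := opposite _ _ m1P m2P m12;
  by [exact: (not_both m)|exact: (not_both m1)|exact: (not_both m2)].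
Qed.

(** Zorn's lemma is applied among Apollonian packings, not among all packings:
    an arbitrary maximal packing need not have the Apollonian property. *)
Definition inextensible P : Prop :=
  forall Q, cone_apollonian Q -> P `<=` Q -> Q `<=` P.

Lemma inextensible_extension S : cone_apollonian S ->
  exists P, [/\ S `<=` P, cone_apollonian P & inextensible P].
Proof.
move=> gS.
(* The family is indexed by S `|` X rather than X, so that the union of the
   empty chain belongs to it. *)
have [F FP tF|A [gA maxA]] := @Zorn_bigcup _ [set X | cone_apollonian (S `|` X)].
  by apply: cone_apollonian_bigcup_chain.
exists (S `|` A); split=> [n|//|Q gQ PQ n nQ]; first by left.
apply: contrapT => nP; apply: (maxA Q).
  split; first by move=> m mA; apply: PQ; right.
  by move=> /(_ n nQ) nA; apply: nP; right.
by rewrite /= (_ : S `|` Q = Q) //; apply/setUidPr => m mS; apply: PQ; left.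
Qed.

(** If a vector v could be added to an inextensible P, then P could be enlarged
    by four mutually tangent discs inside the disc of v: these are disjoint from
    everything that v is disjoint from, and they keep the Apollonian property. *)
Lemma inextensible_maximal P : P !=set0 -> cone_apollonian P ->
  inextensible P -> maximal_packing J P.
Proof.
move=> [m mP] gP maxP; have [[Pn Pc] Pcl] := gP.
split; first split.
- by exists 1; exact: cone_packing_with.
- exact: clustered_not_trivial Pn Pcl mP.
move=> v nPv [[k [k0 kn kc]] _].
have k1 : k = 1 by have := kn m (or_intror mP); rewrite Pn //; lra.
have vv : dot J v v = -1 by rewrite kn ?k1 //; left.
have vP n : P n -> causal (n + v) \/ causal (- (n + v)).
  move=> nP; apply: causal_or_opp; rewrite dotDl !dotDr Pn // vv (dotC v n).
  have : k <= dot J n v by apply: kc; [right|left|move=> nv; apply: nPv; rewrite -nv].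
  by lra.
(* For an n with -(n + v) in the cone, any other n' of P gives a contradiction:
   adding -(n + v) and n + n' to n' + v, resp. to -(n' + v), would put n' + n',
   resp. -(v + v), in the cone, but spacelike vectors are not there. *)
have vPc n : P n -> causal (n + v).
  move=> nP; have [//|nv] := vP n nP; exfalso.
  have [n' [n'P nn']] : exists n', P n' /\ n <> n'.
    have [n1 [_ [_ [[n1P _ _] [d _ _] _]]]] := Pcl n nP.
    by exists n1; split=> // nE; move: d; rewrite -nE Pn //; lra.
  have cnn := Pc _ _ nP n'P nn'.
  have [n'v|n'v] := vP n' n'P.
  - apply: (@spacelike_double n'); first by rewrite Pn //; lra.
    have := causalD cnn (causalD nv n'v); congr causal.
    by rewrite opprD; apply/matrixP => i j; rewrite !mxE; ring.
  - apply: (@spacelike_double (- v)); first by rewrite dotNl dotNr vv; lra.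
    have := causalD cnn (causalD nv n'v); congr causal.
    by rewrite !opprD; apply/matrixP => i j; rewrite !mxE; ring.
have [z1 [z2 [s [s0 inside]]]] := quad_inside vv.
have : cone_apollonian (P `|` range (quad z1 z2 s)).
  apply: cone_apollonianU => //; first exact: cone_apollonian_quad.
  move=> n _ nP [i _ <-] _; have := causalD (vPc n nP) (inside i); congr causal.
  by rewrite addrACA subrr addr0.
move=> /maxP/(_ (@subsetUl _ _ _)) sub.
(* A disc w of the quadruple that is already in P would be both disjoint from v
   and inside v. *)
have wP : P (quad z1 z2 s 0) by apply: sub; right; exists 0.
apply: (@spacelike_double (quad z1 z2 s 0)); first by rewrite Pn //; lra.
have := causalD (inside 0) (vPc _ wP); congr causal.
by rewrite addrACA addNr addr0.
Qed.

(** * Infinitely many classes *)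

(** Each disc contains a point with rational coordinates, and no point p is in two
    of the discs, since n.p < 0 and n'.p < 0 contradict n + n' in the cone. *)
Lemma cone_packing_countable P : cone_packing P -> countable P.
Proof.
move=> [Pn Pc].
have inside n : exists q : rat * rat, P n -> dot J n (null_point (ratr q.1) (ratr q.2)) < 0.
  have [nP|nP] := pselect (P n); last by exists (0, 0).
  by have [|q hq] := @rational_point_inside n; [rewrite Pn //; lra|exists q].
have [f fP] := choice inside.
apply/countable_injP; exists (pickle \o f) => n n' /set_mem nP /set_mem n'P /=.
move=> /(pcan_inj pickleK) fE; apply: contrapT => nn'.
have := fP n nP; have := fP n' n'P; rewrite -fE.
have := causal_dot_ge0 (Pc _ _ nP n'P nn') (causal_point (ratr (f n).1) (ratr (f n).2)).
by rewrite dotDl; lra.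
Qed.

(** A tangent quadruple in the unit disc and its translate by (t, 0), whose
    relative position is recorded by the product of two corresponding discs. *)
Definition two_quads (t : R) : set 'cV[R]_4 :=
  range (quad 0 0 1) `|` range (quad t 0 1).

Lemma cone_apollonian_two_quads t : 3 <= t -> cone_apollonian (two_quads t).
Proof.
move=> t3; apply: cone_apollonianU; [exact: cone_apollonian_quad|exact: cone_apollonian_quad|].
move=> _ _ [i _ <-] [j _ <-] _; apply: disjoint_discs; rewrite ?mul1r.
- by case: (quad_bounds i).
- by case: (quad_bounds j).
have [xi _ ri0 ri1] := quad_bounds i; have [xj _ rj0 rj1] := quad_bounds j.
move: xi xj; rewrite !ler_norml => /andP[xi0 xi1] /andP[xj0 xj1].
set d := (X in _ <= _ + X); have d0 : 0 <= d by exact: sqr_ge0.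
move: (quad_x i) (quad_x j) (quad_r i) (quad_r j) xi0 xi1 xj0 xj1 ri0 ri1 rj0 rj1.
move=> X X' r r' *; suff : (r + r') ^+ 2 <= (0 + X - (t + X')) ^+ 2 by lra.
have -> : (0 + X - (t + X')) ^+ 2 = (t + X' - X) ^+ 2 by ring.
by rewrite ler_pXn2r ?nnegrE //; lra.
Qed.

Definition dot_values P : set R := [set dot J n n' | n in P & n' in P].

Lemma dot_values_countable P : cone_packing P -> countable (dot_values P).
Proof.
move=> /cone_packing_countable cP.
rewrite /dot_values; have -> : [set dot J n n' | n in P & n' in P] =
    [set dot J p.1 p.2 | p in P `*` P].
  apply/seteqP; split=> [_ [n nP [n' n'P <-]]|_ [[n n'] [nP n'P] <-]].
  - by exists (n, n').
  - by exists n => //; exists n'.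
by apply: sub_countable (card_image_le _ _) _; exact: countableX.
Qed.

(** The factor c of an equivalence is 1, because both packings are normalized to
    norm -1. *)
Lemma dot_values_equivalent H P Q : P !=set0 -> cone_packing P -> cone_packing Q ->
  equivalent_packings J H P Q -> dot_values P = dot_values Q.
Proof.
move=> [m mP] [Pn _] [Qn _] [c [T [c0 dotT _ QE]]].
have dotcT u v : dot J (c *: T u) (c *: T v) = c ^+ 2 * dot J u v.
  have trZ : (c *: T u)^T = c *: (T u)^T by apply/matrixP => i j; rewrite !mxE.
  by rewrite -[dot J u v]dotT /dot trZ -!scalemxAl -scalemxAr !mxE; ring.
have c1 : c ^+ 2 = 1.
  have : dot J (c *: T m) (c *: T m) = -1 by apply: Qn; rewrite QE; exists m.
  by rewrite dotcT Pn //; lra.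
apply/seteqP; split=> [_ [n nP [n' n'P <-]]|r].
- exists (c *: T n); first by rewrite QE; exists n.
  by exists (c *: T n'); [rewrite QE; exists n'|rewrite dotcT c1 mul1r].
- rewrite QE => -[_ [n nP <-] [_ [n' n'P <-] <-]].
  by exists n => //; exists n' => //; rewrite dotcT c1 mul1r.
Qed.

Lemma two_quads_dot_value P t : two_quads t `<=` P -> dot_values P (2 * t ^+ 2 - 1).
Proof.
move=> sub; exists (quad 0 0 1 0); first by apply: sub; left; exists 0.
exists (quad t 0 1 0); first by apply: sub; right; exists 0.
rewrite dot_discs ?lt0r_neq0 ?quad_r_gt0 // /quad_r /quad_x /quad_y /=.
by field.
Qed.

(** One packing is chosen for each set of products that occurs, so that distinct
    packings of the family have distinct sets of products. *)
Lemma infinitely_many_inequivalent H : exists S : set (set 'cV[R]_4),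
    [/\ infinite_set S,
        forall P, S P -> maximal_packing J P /\ apollonian J P &
        forall P Q, S P -> S Q -> P <> Q -> ~ equivalent_packings J H P Q].
Proof.
have ext t : exists P, 3 <= t ->
    [/\ two_quads t `<=` P, cone_apollonian P & inextensible P].
  have [t3|t3] := pselect (3 <= t); last by exists set0.
  by have [P hP] := inextensible_extension (cone_apollonian_two_quads t3); exists P.
have [P hP] := choice ext.
have P0 t : 3 <= t -> P t !=set0.
  by move=> /hP[sub _ _]; exists (quad 0 0 1 0); apply: sub; left; exists 0.
pose C := [set dot_values (P t) | t in [set t | 3 <= t]].
have rep A : exists t, C A -> 3 <= t /\ dot_values (P t) = A.
  by have [[t t3 tA]|nA] := pselect (C A); [exists t|exists 0].
have [g gP] := choice rep.
exists [set P (g A) | A in C]; split.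
- apply: contra_not (_ : ~ finite_set C).
    move=> fS; rewrite (_ : C = [set dot_values Q | Q in [set P (g A) | A in C]]).
      exact: finite_image.
    apply/seteqP; split=> [A CA|_ [_ [A CA <-] <-]].
      by exists (P (g A)); [exists A|case: (gP A CA)].
    by case: (gP A CA) => _ ->.
  move=> fC.
  have cU : countable (\bigcup_(A in C) A).
    apply: bigcup_countable; first exact: finite_set_countable.
    by move=> _ [t /hP[_ [cP _] _] <-]; exact: dot_values_countable.
  (* Already the values 2 t^2 - 1 for t between 3 and 4 are too many: the interval
     has Lebesgue measure 1. *)
  have c34 : countable `[3%R, 4%R : R]%classic.
    pose f (t : R) := 2 * t ^+ 2 - 1.
    have fsub : f @` `[3%R, 4%R]%classic `<=` \bigcup_(A in C) A.
      move=> r [t]; rewrite /= in_itv /= => /andP[t3 _] <-.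
      exists (dot_values (P t)); first by exists t.
      by apply: two_quads_dot_value; case: (hP t t3).
    rewrite -(eq_countable (@inj_card_eq _ _ _ f _)).
      by apply: sub_countable cU; exact: subset_card_le.
    move=> s t /set_mem /=; rewrite in_itv /= => /andP[s3 _] /set_mem /=.
    rewrite in_itv /= => /andP[t3 _]; rewrite /f => h.
    have : (s - t) * (s + t) = 0 by move: h; lra.
    by move=> /eqP; rewrite mulf_eq0 subr_eq0 => /orP[/eqP//|/eqP]; lra.
  have := countable_lebesgue_measure0 c34.
  rewrite lebesgue_measure_itv /= lte_fin ltr_nat /= -EFinB => -[].
  lra.
- move=> _ [A CA <-]; have [t3 _] := gP A CA; have [sub gPA maxP] := hP _ t3.
  split; last exact: apollonian_of_cone_apollonian.
  by apply: inextensible_maximal => //; exact: P0.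
- move=> _ _ [A CA <-] [B CB <-] AB eqPQ; apply: AB.
  have [tA EA] := gP A CA; have [tB EB] := gP B CB.
  have [_ [cA _] _] := hP _ tA; have [_ [cB _] _] := hP _ tB.
  have := dot_values_equivalent (P0 _ tA) cA cB eqPQ.
  by rewrite EA EB => ->.
Qed.

End LightCone.

Theorem theorem3p1 (R : realType) (J : 'M[R]_4) (H : set 'cV[R]_4)
    (hJ : signature13 J) (hH : is_sheet J H) :
  exists S : set (set 'cV[R]_4),
    [/\ infinite_set S,
        forall P, S P -> maximal_packing J P /\ apollonian J P &
        forall P Q, S P -> S Q -> P <> Q -> ~ equivalent_packings J H P Q].
Proof.
have [a [b [x [y [mk [dotE mkE]]]]]] := light_cone_coordinates hJ.
exact: infinitely_many_inequivalent dotE mkE H.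
Qed.
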